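(* Let $s\in\{0,\tfrac12\}$. Every irreducible Harish-Chandra module over the Schr\''odinger-Virasoro algebra $\mathcal{L}[s]$ is a highest weight module, a lowest weight module, or a uniformly bounded module. *)

(* Defs.v *)
From HB Require Import structures.
From mathcomp Require Import all_boot all_order all_algebra.
Set Implicit Arguments. Unset Strict Implicit. Unset Printing Implicit Defensive.
Import Order.TTheory GRing.Theory Num.Theory.
Local Open Scope ring_scope.

(* The Schroedinger-Virasoro algebra L[s], s in {0, 1/2}, encoded by the
   boolean [hs] (hs = false <-> s = 0, hs = true <-> s = 1/2).  It has basis
   L_n, M_n (n : int) and Y_{n+s} (n : int); the basis element Y_{n+s} is
   indexed below by the integer n.  Brackets:
     [L_m, L_n]         = (n - m) L_{m+n}
     [L_m, M_n]         = n M_{m+n}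
     [L_m, Y_{n+s}]     = (n + s - m/2) Y_{m+n+s}
     [Y_{m+s}, Y_{n+s}] = (n - m) M_{m+n+2s}
     [M_m, M_n] = [Y_{m+s}, M_n] = 0.
   A module over L[s] on an F-vector space V is given by the (linear) actions
   of the basis elements, satisfying the bracket relations. *)

Definition sval (F : fieldType) (hs : bool) : F := if hs then 2^-1 else 0.

Record SVmodule (F : fieldType) (hs : bool) (V : lmodType F) := SVModule {
  actL : int -> {linear V -> V};
  actM : int -> {linear V -> V};
  actY : int -> {linear V -> V};
  relLL : forall m n v, actL m (actL n v) - actL n (actL m v)
                        = (n - m)%:~R *: actL (m + n) v;
  relLM : forall m n v, actL m (actM n v) - actM n (actL m v)
                        = n%:~R *: actM (m + n) v;
  relLY : forall m n v, actL m (actY n v) - actY n (actL m v)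
                        = (n%:~R + sval F hs - m%:~R / 2) *: actY (m + n) v;
  relYY : forall m n v, actY m (actY n v) - actY n (actY m v)
                        = (n - m)%:~R *: actM (m + n + (hs : nat)%:Z) v;
  relMM : forall m n v, actM m (actM n v) = actM n (actM m v);
  relYM : forall m n v, actY m (actM n v) = actM n (actY m v)
}.

Section SVDefs.
Variables (F : fieldType) (hs : bool) (V : lmodType F) (W : SVmodule hs V).

(* Y_{n+s} has positive (resp. negative) degree iff n + s > 0 (resp. < 0). *)
Definition Ypos (n : int) : bool := 0 < n *+ 2 + (hs : nat)%:Z.
Definition Yneg (n : int) : bool := n *+ 2 + (hs : nat)%:Z < 0.

Definition submodule (S : V -> Prop) : Prop :=
  [/\ S 0,
      (forall u v, S u -> S v -> S (u + v)),
      (forall (a : F) v, S v -> S (a *: v)) &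
      (forall n v, S v -> [/\ S (actL W n v), S (actM W n v) & S (actY W n v)])].

Definition irreducible : Prop :=
  (exists v : V, v != 0) /\
  forall S, submodule S -> (forall v, S v -> v = 0) \/ (forall v, S v).

Definition generated_by (v : V) : Prop :=
  forall S, submodule S -> S v -> forall w, S w.

(* weight spaces for the Cartan subalgebra h = span{L_0, M_0};
   a weight is (a, b) : F * F, the values on L_0 and M_0 *)
Definition weight_space (lam : F * F) (v : V) : Prop :=
  actL W 0 v = lam.1 *: v /\ actM W 0 v = lam.2 *: v.

Definition weight_vector (v : V) : Prop := exists lam, weight_space lam v.

Definition dim_le (P : V -> Prop) (d : nat) : Prop :=
  forall f : 'I_d.+1 -> V, (forall i, P (f i)) ->
    exists c : 'I_d.+1 -> F, (exists i, c i != 0) /\ \sum_i c i *: f i = 0.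

Definition harish_chandra : Prop :=
  (forall v : V, exists s : seq V,
      (forall w, w \in s -> weight_vector w) /\ v = \sum_(w <- s) w)
  /\ forall lam, exists d, dim_le (weight_space lam) d.

Definition uniformly_bounded : Prop :=
  exists N, forall lam, dim_le (weight_space lam) N.

Definition highest_weight_module : Prop :=
  exists v : V, [/\ v != 0, weight_vector v,
    (forall n : int, 0 < n -> actL W n v = 0 /\ actM W n v = 0),
    (forall n : int, Ypos n -> actY W n v = 0) & generated_by v].

Definition lowest_weight_module : Prop :=
  exists v : V, [/\ v != 0, weight_vector v,
    (forall n : int, n < 0 -> actL W n v = 0 /\ actM W n v = 0),
    (forall n : int, Yneg n -> actY W n v = 0) & generated_by v].

End SVDefs.

(* Main.v *)
(* Let [v] be nonzero of weight [(a, b)]; by irreducibility every weight is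
   [(a + j/2, b)] for some integer [j].  If the dimensions are unbounded as
   [j -> -oo], some weight space with [j ~ -2p] is too large for [L_p], [L_(p+1)],
   [M_p], [Y_p], which map it into finitely many fixed weight spaces, to have no
   common kernel, and a common kernel vector is killed by all [X_n] with [n] large.
   The vectors with the latter property form a submodule, hence are everything.
   By finite-dimensionality, one [N] works for the weight spaces [j = 0, 1]; if
   [x] has weight [j = 2q + r] with [q >= N], then [X_n L_(-q) x = 0] for [n >= N],
   and commuting with [L_(-q)] lowers the annihilation bound of [x] down to
   [N - q <= 0], so [x] is a highest weight vector.  Nonzero such [x] exist unless
   climbing from [v] stops earlier, again at a highest weight vector.  The case
   [j -> +oo] follows by reflecting the grading. *)

Require Import Defs.
From HB Require Import structures.
From mathcomp Require Import all_boot all_order all_algebra.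
From mathcomp Require Import zify ring.
From Stdlib Require Import Classical.
Set Implicit Arguments. Unset Strict Implicit. Unset Printing Implicit Defensive.
Import Order.TTheory GRing.Theory Num.Theory.
Local Open Scope ring_scope.

Section Dimension.
Variables (F : fieldType) (V : lmodType F).
Implicit Types (P Q : V -> Prop) (T : {linear V -> V}).

Definition subspace P : Prop :=
  [/\ P 0, forall u v, P u -> P v -> P (u + v) & forall a v, P v -> P (a *: v)].

Lemma subspace_sum P (I : finType) (c : I -> F) (f : I -> V) :
  subspace P -> (forall i, P (f i)) -> P (\sum_i c i *: f i).
Proof. by case=> P0 PD PZ Pf; apply: big_ind => // i _; apply: PZ. Qed.

Lemma subspace_ker P T : subspace P -> subspace (fun v => P v /\ T v = 0).
Proof.
case=> P0 PD PZ; split=> [|u v [Pu Tu] [Pv Tv]|a v [Pv Tv]].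
- by rewrite linear0.
- by split; [apply: PD | rewrite linearD Tu Tv addr0].
- by split; [apply: PZ | rewrite linearZ_LR /= Tv scaler0].
Qed.

Lemma dim_le_relation P d m (f : 'I_m -> V) :
  dim_le P d -> (d < m)%N -> (forall i, P (f i)) ->
  exists c : 'I_m -> F, (exists i, c i != 0) /\ \sum_i c i *: f i = 0.
Proof.
move=> Pd ltdm; have /esym Dm := subnKC ltdm.
move: (m - d.+1)%N Dm => k Dm; rewrite {}Dm in f * => Pf.
have [c [[i ci] sum_c]] := Pd _ (fun i => Pf (lshift k i)).
exists (row_mx (\row_j c j) (0 : 'rV_k) 0); split.
  by exists (lshift k i); rewrite row_mxEl mxE.
rewrite big_split_ord /= [X in _ + X]big1 => [|j _]; last first.
  by rewrite row_mxEr mxE scale0r.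
by rewrite addr0 -[RHS]sum_c; apply: eq_bigr => j _; rewrite row_mxEl mxE.
Qed.

Lemma dim_le_mono P Q d e :
  (forall v, P v -> Q v) -> (d <= e)%N -> dim_le Q d -> dim_le P e.
Proof.
by move=> PQ le_de Qd f Pf; apply: (dim_le_relation Qd) => // i; apply: PQ.
Qed.

Lemma not_dim_le P d : ~ dim_le P d ->
  exists f : 'I_d.+1 -> V, (forall i, P (f i)) /\
    forall c : 'I_d.+1 -> F, \sum_i c i *: f i = 0 -> forall i, c i = 0.
Proof.
move=> nPd; apply: NNPP => nf; apply: nPd => f Pf.
apply: NNPP => nc; apply: nf; exists f; split=> // c sum_c i.
by apply/eqP/negPn/negP => ci; apply: nc; exists c; split; first exists i.
Qed.

Lemma not_dim_le0 P : ~ dim_le P 0 -> exists2 v, P v & v != 0.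
Proof.
move=> /not_dim_le[f [Pf free_f]]; exists (f ord0) => //.
apply/eqP => f0; have := free_f (fun=> 1).
rewrite big_ord1 f0 scaler0 => /(_ erefl ord0)/eqP.
by rewrite oner_eq0.
Qed.

Lemma dim_le_span P d : dim_le P d ->
  exists2 e, (e <= d)%N & exists g : 'I_e -> V,
    forall v, P v -> exists c : 'I_e -> F, v = \sum_i c i *: g i.
Proof.
elim: d => [|d IHd] Pd.
  exists 0%N => //; exists (fun=> 0) => v Pv.
  exists (fun=> 0); rewrite big_ord0; apply/eqP/negPn/negP => v0.
  have [//|c [[i]]] := Pd (fun=> v); rewrite ord1 big_ord1 => ci /eqP.
  by rewrite scaler_eq0 (negPf ci) (negPf v0).
have [/IHd[e le_ed ge]|/not_dim_le[f [Pf free_f]]] := classic (dim_le P d).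
  by exists e; first exact: leqW.
exists d.+1 => //; exists f => v Pv.
have [|c [[i ci]]] := Pd (fun i => oapp f v (unlift ord0 i)).
  by move=> i; case: (unlift ord0 i) => [j|] /=; first exact: Pf.
rewrite big_ord_recl unlift_none /= => sum_c.
have {}sum_c: c ord0 *: v + \sum_i c (lift ord0 i) *: f i = 0.
  by rewrite -[RHS]sum_c; congr (_ + _); apply: eq_bigr => j _; rewrite liftK.
have [c0|c0] := eqVneq (c ord0) 0.
  rewrite c0 scale0r add0r in sum_c.
  have := free_f (fun j => c (lift ord0 j)) sum_c.
  case: (unliftP ord0 i) ci => [j|] ->; last by rewrite c0 eqxx.
  by move=> cj /(_ j)/eqP; rewrite (negPf cj).
exists (fun j => - ((c ord0)^-1 * c (lift ord0 j))).
have /(congr1 (fun w => (c ord0)^-1 *: w)) := sum_c.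
rewrite scaler0 scalerDr scalerA mulVf // scale1r => /eqP.
rewrite addr_eq0 => /eqP->; rewrite scaler_sumr -sumrN.
by apply: eq_bigr => j _; rewrite scalerA scaleNr.
Qed.

Lemma dim_le_ker P Q T d e : subspace P -> (forall v, P v -> Q (T v)) ->
  dim_le Q d -> dim_le (fun v => P v /\ T v = 0) e -> dim_le P (d + e).
Proof.
move=> subP PQ /dim_le_span[d' le_d'd [g gP]] ker_e f Pf.
have /fin_all_exists[A TfA]: forall i, exists c : 'I_d' -> F,
    T (f i) = \sum_j c j *: g j by move=> i; apply/gP/PQ/Pf.
pose B := row_base (kermx (\matrix_(i, j) A i j)).
have BA0: B *m \matrix_(i, j) A i j = 0.
  by apply/sub_kermxP; rewrite eq_row_base.
have rk_gt: (e < \rank (kermx (\matrix_(i, j) A i j)))%N.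
  rewrite mxrank_ker; have := rank_leq_col (\matrix_(i, j) A i j).
  by move: (\rank _) le_d'd => r; lia.
have [k|c [[k ck] sum_c]] :=
    dim_le_relation (f := fun k => \sum_i B k i *: f i) ker_e rk_gt.
  split; first exact: subspace_sum.
  rewrite linear_sum.
  transitivity (\sum_i \sum_j (B k i * A i j) *: g j).
    apply: eq_bigr => i _; rewrite linearZ_LR TfA scaler_sumr.
    by apply: eq_bigr => j _; rewrite scalerA.
  rewrite exchange_big big1 // => j _; rewrite -scaler_suml.
  have /matrixP/(_ k j) := BA0; rewrite !mxE => BA0kj.
  rewrite [X in X *: _](_ : _ = 0) ?scale0r // -[RHS]BA0kj.
  by apply: eq_bigr => i _; rewrite !mxE.
exists (((\row_k c k) *m B) 0); split.
  apply: NNPP => nz; case/eqP: ck.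
  have /row_free_inj Binj := row_base_free (kermx (\matrix_(i, j) A i j)).
  have /Binj/matrixP/(_ 0 k): (\row_k c k) *m B = 0 *m B.
    rewrite mul0mx; apply/matrixP => i j; rewrite ord1 [RHS]mxE.
    by apply/eqP/negPn/negP => cj; apply: nz; exists j.
  by rewrite !mxE.
rewrite -[RHS]sum_c.
transitivity (\sum_i \sum_k (c k * B k i) *: f i).
  apply: eq_bigr => i _; rewrite mxE scaler_suml.
  by apply: eq_bigr => j _; rewrite !mxE.
rewrite exchange_big; apply: eq_bigr => j _; rewrite scaler_sumr.
by apply: eq_bigr => i _; rewrite scalerA.
Qed.

End Dimension.

Lemma intr_neq0 (F : fieldType) : [pchar F] =i pred0 ->
  forall n : int, n != 0 -> n%:~R != 0 :> F.
Proof.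
move=> /pcharf0P F0 [] n nz; first by rewrite F0.
by rewrite NegzE rmorphN oppr_eq0 F0.
Qed.

Inductive kind := KL | KM | KY.

Section Module.
Variables (F : fieldType) (hF : [pchar F] =i pred0) (hs : bool).
Variables (V : lmodType F) (W : SVmodule hs V).

Definition act (k : kind) (n : int) : {linear V -> V} :=
  match k with KL => actL W n | KM => actM W n | KY => actY W n end.

Definition shift (k : kind) : int := if k is KY then (hs : nat)%:Z else 0.

(* Twice the coefficient in [L_m, X_n], to remain in the integers. *)
Definition coef (k : kind) (m n : int) : int :=
  match k with
  | KL => (n - m) *+ 2
  | KM => n *+ 2
  | KY => n *+ 2 + (hs : nat)%:Z - m
  end.

Lemma two_neq0 : 2 != 0 :> F.
Proof. exact: (@intr_neq0 F hF 2). Qed.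

Lemma L_act k m n v : act KL m (act k n v) - act k n (act KL m v)
  = ((coef k m n)%:~R / 2) *: act k (m + n) v.
Proof.
case: k => /=.
- by rewrite relLL rmorphMn /= -[X in X / _]mulr_natr mulfK // two_neq0.
- by rewrite relLM rmorphMn /= -[X in X / _]mulr_natr mulfK // two_neq0.
rewrite relLY; congr (_ *: _); rewrite rmorphB rmorphD rmorphMn /= /sval.
case: (hs) => /=; field; exact: two_neq0.
Qed.

Lemma act_kernel k m n v : coef k m n != 0 ->
  act KL m (act k n v) = 0 -> act k n (act KL m v) = 0 -> act k (m + n) v = 0.
Proof.
move=> c_neq0 e1 e2; have := L_act k m n v; rewrite e1 e2 subrr => /esym/eqP.
rewrite scaler_eq0 mulf_eq0 invr_eq0 (negPf two_neq0).
by rewrite (negPf (intr_neq0 hF c_neq0)) => /eqP.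
Qed.

Lemma act_comm k n k' m : exists c k'' e, 0 <= e /\
  forall v, act k n (act k' m v)
            = act k' m (act k n v) + c *: act k'' (n + m + e) v.
Proof.
have LX x p q : exists c k'' e, 0 <= e /\ forall v, act KL p (act x q v)
      = act x q (act KL p v) + c *: act k'' (p + q + e) v.
  exists ((coef x p q)%:~R / 2), x, 0; split=> // v.
  by rewrite addr0 -L_act addrC subrK.
have XL x p q : exists c k'' e, 0 <= e /\ forall v, act x p (act KL q v)
      = act KL q (act x p v) + c *: act k'' (p + q + e) v.
  exists (- ((coef x q p)%:~R / 2)), x, 0; split=> // v.
  by rewrite addr0 scaleNr (addrC p) -L_act opprB addrC subrK.
have C0 x p y q : (forall v, act x p (act y q v) = act y q (act x p v)) ->
    exists c k'' e, 0 <= e /\ forall v, act x p (act y q v)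
      = act y q (act x p v) + c *: act k'' (p + q + e) v.
  by move=> xy; exists 0, KL, 0; split=> // v; rewrite scale0r addr0.
case: k; case: k'; try exact: LX; try exact: XL.
- by apply: C0 => v; apply: relMM.
- by apply: C0 => v; symmetry; apply: relYM.
- by apply: C0 => v; apply: relYM.
exists (m - n)%:~R, KM, (hs : nat)%:Z; split=> // v.
by rewrite /= -relYY addrC subrK.
Qed.

Lemma submoduleI (S : V -> Prop) :
  subspace S -> (forall k n v, S v -> S (act k n v)) -> submodule W S.
Proof.
case=> S0 SD SZ Sact; split=> // n v Sv.
by split; [apply: (Sact KL) | apply: (Sact KM) | apply: (Sact KY)].
Qed.

Lemma irreducible_full S v : irreducible W -> submodule W S -> S v -> v != 0 ->
  forall w, S w.
Proof. by case=> _ irr /irr[S0 /S0->|//]; rewrite eqxx. Qed.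

Lemma irreducible_generated v : irreducible W -> v != 0 -> generated_by W v.
Proof. by move=> irr v0 S subS Sv; apply: (irreducible_full irr subS Sv v0). Qed.

Lemma weight_subspace lam : subspace (weight_space W lam).
Proof.
split=> [|u v [u1 u2] [v1 v2]|a v [v1 v2]].
- by split; rewrite linear0 scaler0.
- by split; rewrite linearD ?u1 ?u2 ?v1 ?v2 scalerDr.
- by split; rewrite linearZ_LR ?v1 ?v2 !scalerA mulrC.
Qed.

Definition weights (a b : F) (j : int) : V -> Prop :=
  weight_space W (a + j%:~R / 2, b).

Lemma weights_act a b j k n v :
  weights a b j v -> weights a b (j + (n *+ 2 + shift k)) (act k n v).
Proof.
case=> /= v1 v2; split=> /=; last first.
  transitivity (act k n (actM W 0 v)); last by rewrite v2 linearZ_LR.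
  case: k => /=; [|exact: relMM|by rewrite relYM].
  have := relLM W n 0 v; rewrite scale0r => /eqP.
  by rewrite subr_eq0 => /eqP.
have := L_act k 0 n v; rewrite add0r /= v1 linearZ_LR /= => /eqP.
rewrite subr_eq => /eqP->; rewrite -scalerDl; congr (_ *: _).
have -> : coef k 0 n = n *+ 2 + shift k by case: k => /=; lia.
rewrite (rmorphD _ j) /= mulrDl addrCA.
by congr (_ + _); apply: addrC.
Qed.

Lemma weights_independent (P : F * F -> Prop) lam (s : seq V) w :
  (forall x, x \in s -> exists2 mu, P mu & weight_space W mu x) ->
  ~ P lam -> weight_space W lam w -> w = \sum_(x <- s) x -> w = 0.
Proof.
move=> Ps nPlam.
elim: (size s) {-2}s (erefl (size s)) w Ps => {s} [|n IHn] [|x s] //=.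
  by move=> _ w _ _; rewrite big_nil.
move=> [size_s] w Ps.
have [mu Pmu [x1 x2]] := Ps x (mem_head x s).
have kill (X : {linear V -> V}) (pr : F * F -> F) :
    (forall nu y, weight_space W nu y -> X y = pr nu *: y) ->
    pr mu != pr lam -> weight_space W lam w -> w = \sum_(y <- x :: s) y -> w = 0.
  move=> Xpr neq_pr Ww def_w; apply/eqP.
  have: (pr lam - pr mu) *: w = 0.
    apply: (IHn [seq X y - pr mu *: y | y <- s]); first by rewrite size_map.
    - move=> _ /mapP[y sy ->]; have [|nu Pnu Wy] := Ps y.
        by rewrite inE sy orbT.
      exists nu => //; rewrite (Xpr _ _ Wy) -scalerBl.
      by have [_ _ WZ] := weight_subspace nu; apply: WZ.
    - by have [_ _ WZ] := weight_subspace lam; apply: WZ.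
    rewrite scalerBl -(Xpr _ _ Ww) def_w linear_sum scaler_sumr -sumrB big_cons.
    by rewrite (Xpr mu) ?subrr ?add0r ?big_map.
  by move/eqP; rewrite scaler_eq0 subr_eq0 eq_sym (negPf neq_pr).
have [eq1|neq1] := eqVneq mu.1 lam.1; last first.
  by apply: (kill (actL W 0) fst) => // nu y [].
have [eq2|neq2] := eqVneq mu.2 lam.2; last first.
  by apply: (kill (actM W 0) snd) => // nu y [].
move=> _ _; case: nPlam.
by rewrite [lam]surjective_pairing -eq1 -eq2 -surjective_pairing.
Qed.

Lemma weights_full a b v0 lam w : irreducible W -> harish_chandra W ->
  v0 != 0 -> weights a b 0 v0 -> w != 0 -> weight_space W lam w ->
  exists j, lam = (a + j%:~R / 2, b).
Proof.
move=> irr [_ _] v0_neq0 Wv0 w_neq0 Ww.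
pose S v := exists2 s : seq V,
  (forall x, x \in s -> exists j, weights a b j x) & v = \sum_(x <- s) x.
have subS : submodule W S.
  apply: submoduleI; first split.
  - by exists [::]; rewrite ?big_nil.
  - move=> _ _ [s Ws ->] [t Wt ->]; exists (s ++ t); last by rewrite big_cat.
    by move=> x; rewrite mem_cat => /orP[/Ws|/Wt].
  - move=> c _ [s Ws ->]; exists [seq c *: x | x <- s].
      move=> _ /mapP[x /Ws[j Wx] ->]; exists j.
      by have [_ _ WZ] := weight_subspace (a + j%:~R / 2, b); apply: WZ.
    by rewrite big_map scaler_sumr.
  move=> k n _ [s Ws ->]; exists [seq act k n x | x <- s].
    by move=> _ /mapP[x /Ws[j Wx] ->]; eexists; apply: weights_act Wx.
  by rewrite big_map linear_sum.
have Sv0 : S v0.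
  exists [:: v0]; last by rewrite big_seq1.
  by move=> x; rewrite inE => /eqP->; exists 0.
have [s Ws def_w] := irreducible_full irr subS Sv0 v0_neq0 w.
apply: NNPP => nlam; case/eqP: w_neq0.
pose P mu := exists j, mu = (a + j%:~R / 2, b).
apply: (weights_independent (P := P) _ nlam Ww def_w).
by move=> x /Ws[j Wx]; exists (a + j%:~R / 2, b) => //; exists j.
Qed.

Definition highest_vector v := forall k n, 0 < n *+ 2 + shift k -> act k n v = 0.

Lemma highest_vectorP v lam : irreducible W -> v != 0 -> weight_space W lam v ->
  highest_vector v -> highest_weight_module W.
Proof.
move=> irr v0 Wv hv; exists v; split=> //; first by exists lam.
- by move=> n n_gt0; split; [apply: (hv KL) | apply: (hv KM)]; rewrite /=; lia.
- by move=> n; apply: (hv KY).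
exact: irreducible_generated.
Qed.

Definition killed_from (N : int) v := forall k n, N <= n -> act k n v = 0.

Lemma killed_submodule : submodule W (fun v => exists N, killed_from N v).
Proof.
apply: submoduleI; first split.
- by exists 0 => k n _; rewrite linear0.
- move=> u v [N Nu] [N' Nv]; exists (Num.max N N') => k n.
  rewrite ge_max => /andP[? ?].
  by rewrite linearD Nu // Nv // addr0.
- by move=> c v [N Nv]; exists N => k n le_Nn; rewrite linearZ_LR Nv // scaler0.
move=> k m v [N Nv]; exists (N + `|m|) => k' n le_n.
have [c [k'' [e [e_ge0 ->]]]] := act_comm k' n k m.
by rewrite !Nv ?linear0 ?scaler0 ?addr0 //; lia.
Qed.

Lemma killed_from_uniform lam d : dim_le (weight_space W lam) d ->
  (forall v, exists N, killed_from N v) ->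
  exists N, forall v, weight_space W lam v -> killed_from N v.
Proof.
case/dim_le_span=> e _ [g gP] allN.
have [N gN] := fin_all_exists (fun i => allN (g i)).
exists (\sum_i `|N i|) => v /gP[c ->] k n le_n.
rewrite linear_sum big1 // => i _; rewrite linearZ_LR gN ?scaler0 //.
apply: le_trans (le_trans (ler_norm _) _) le_n.
by rewrite (bigD1 i) //= lerDl sumr_ge0.
Qed.

(* As [[L_(-q), X_n] x] is a nonzero multiple of [X_(n-q) x], the bound [p] can be
   lowered by one as long as [p > N - q]. *)
Lemma killed_from_shift (N q : int) x : 0 < N -> 0 < q ->
  killed_from N (act KL (- q) x) -> (exists p, killed_from p x) ->
  killed_from (N - q) x.
Proof.
move=> N_gt0 q_gt0 Nx [p px].
have: killed_from (N - q + (absz (p - (N - q))%R)%:Z) x.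
  by move=> k n le_n; apply: px; lia.
elim: (absz _) => [|t IHt] tx; first by rewrite addr0 in tx.
apply: IHt => k n le_n; have := @act_kernel k (- q) (n + q) x.
rewrite [- q + _]addrC addrK; apply.
- by case: (k) => /=; lia.
- by rewrite tx ?linear0 //; lia.
- by apply: Nx; lia.
Qed.

Lemma highest_weight_of_killed a b v0 : irreducible W -> harish_chandra W ->
  v0 != 0 -> weights a b 0 v0 -> (forall v, exists N, killed_from N v) ->
  highest_weight_module W.
Proof.
move=> irr [_ hdim] v0_neq0 Wv0 allN.
have unif j : exists N, forall v, weights a b j v -> killed_from N v.
  by have [d Hd] := hdim (a + j%:~R / 2, b); apply: killed_from_uniform Hd allN.
have [[N0 HN0] [N1 HN1]] := (unif 0, unif 1).
pose N : int := `|N0| + `|N1| + 1.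
have high j x : N *+ 2 <= j -> weights a b j x -> highest_vector x.
  move=> le_Nj Wx k n n_gt0; pose q := (j %/ 2)%Z.
  apply: (@killed_from_shift N q) => //; try by rewrite /q /N; lia.
    have := weights_act KL (- q) Wx; rewrite /= addr0.
    have [->|->] : j + (- q) *+ 2 = 0 \/ j + (- q) *+ 2 = 1 by rewrite /q; lia.
      by move=> W0 k' n' le_n'; apply: (HN0 _ W0); rewrite /N in le_n'; lia.
    by move=> W1 k' n' le_n'; apply: (HN1 _ W1); rewrite /N in le_n'; lia.
  by case: (k) n_gt0 => /=; rewrite /q /N in le_Nj *; lia.
have climb (t : nat) j x : x != 0 -> weights a b j x -> N *+ 2 <= j + t%:Z ->
    highest_weight_module W.
  elim: t j x => [|t IHt] j x x_neq0 Wx le_j.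
    rewrite addr0 in le_j.
    exact: highest_vectorP irr x_neq0 Wx (high _ _ le_j Wx).
  apply: NNPP => nhw; case: (nhw).
  apply: (highest_vectorP irr x_neq0 Wx) => k n n_gt0.
  apply: NNPP => /eqP nx; case: nhw.
  by apply: IHt nx (weights_act k n Wx) _; lia.
by apply: (climb (absz (N *+ 2)%R) 0 v0) => //; lia.
Qed.

Lemma semigroup_closed (p : int) (K : int -> Prop) : 0 < p ->
  K (p *+ 2 + 1) ->
  (forall n, p + 1 < n -> K n -> K (p + n) /\ K (p + 1 + n)) ->
  forall n, p *+ 2 + 1 + p * p <= n -> K n.
Proof.
move=> p_gt0 K0 Kstep n le_n.
have Kmul (i j : nat) : K (p *+ 2 + 1 + p * i%:Z + (p + 1) * j%:Z).
  elim: i => [|i IHi].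
    elim: j => [|j IHj]; first by rewrite !mulr0 !addr0.
    have [|_] := Kstep _ _ IHj; first nia.
    by congr K; lia.
  have [|+ _] := Kstep _ _ IHi; first nia.
  by congr K; lia.
pose m := n - (p *+ 2 + 1).
have := Kmul (absz ((m %/ p)%Z - (m %% p)%Z)%R) (absz (m %% p)%Z).
congr K.
have := divz_eq m p; have := modz_ge0 m (lt0r_neq0 p_gt0); have := ltz_pmod m p_gt0.
have: p * p <= m by rewrite /m; lia.
have: n = p *+ 2 + 1 + m by rewrite /m; lia.
move: (m %/ p)%Z (m %% p)%Z => q r -> le_m lt_r r_ge0 def_m.
have: r <= q by nia.
by nia.
Qed.

Lemma killed_of_generators (p : int) v : 1 < p ->
  (forall k, act k p v = 0) -> act KL (p + 1) v = 0 ->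
  exists N, killed_from N v.
Proof.
move=> p_gt1 kp lp1; exists (p *+ 2 + 1 + p * p) => k.
apply: (semigroup_closed (K := fun n => act k n v = 0)); first lia.
  have -> : p *+ 2 + 1 = (p + 1) + p by lia.
  by apply: act_kernel; rewrite ?kp ?lp1 ?linear0 //; case: (k) => /=; lia.
move=> n lt_n nv; split.
  by apply: act_kernel; rewrite ?nv ?(kp KL) ?linear0 //; case: (k) => /=; lia.
by apply: act_kernel; rewrite ?nv ?lp1 ?linear0 //; case: (k) => /=; lia.
Qed.

Lemma highest_weight_of_unbounded a b v0 : irreducible W -> harish_chandra W ->
  v0 != 0 -> weights a b 0 v0 ->
  (forall N, exists j, j < 0 /\ ~ dim_le (weights a b j) N) ->
  highest_weight_module W.
Proof.
move=> irr hc v0_neq0 Wv0 unb; have [_ hdim] := hc.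
have {hdim} hdim (lo : int) : exists d, forall i : nat, (i < 8)%N ->
    dim_le (weights a b (lo + i%:Z)) d.
  have [d Hd] := fin_all_exists
    (fun i : 'I_8 => hdim (a + (lo + (i : nat)%:Z)%:~R / 2, b)).
  exists (\max_i d i) => i lt_i8; apply: dim_le_mono (Hd (Ordinal lt_i8)) => //.
  exact: leq_bigmax.
have [d Hd] := hdim (- 4).
have {}Hd j : -4 <= j < 4 -> dim_le (weights a b j) d.
  move=> /andP[ge_j lt_j]; have := Hd (absz (j + 4)%R).
  by rewrite (_ : -4 + (absz (j + 4)%R)%:Z = j); [apply|]; lia.
have [j [j_lt0 ndim]] := unb (d + (d + (d + (d + 0))))%N.
have lt_j4 : j < -4.
  rewrite ltNge; apply/negP => le_j; apply: ndim.
  by apply: dim_le_mono (Hd j _) => //; [rewrite leq_addr | lia].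
pose p := - (j %/ 2)%Z.
have dimp k n : p <= n <= p + (if k is KL then 1 else 0) ->
    dim_le (weights a b (j + (n *+ 2 + shift k))) d.
  move=> le_n; apply: Hd; move: le_n; rewrite /p.
  by case: k => /=; case: (hs) => /=; lia.
have sub0 := weight_subspace (a + j%:~R / 2, b).
have sub1 := subspace_ker (act KL p) sub0.
have sub2 := subspace_ker (act KM p) sub1.
have sub3 := subspace_ker (act KY p) sub2.
have [ker0|v [[[[Wv lp] mp] yp] lp1] v_neq0] := @not_dim_le0 _ _
    (fun v => ((((weights a b j v /\ act KL p v = 0) /\ act KM p v = 0)
      /\ act KY p v = 0) /\ act KL (p + 1) v = 0)).
  apply: ndim.
  apply: (dim_le_ker (T := act KL p) sub0 _ (dimp KL p _)); [|lia|].
    by move=> v /weights_act.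
  apply: (dim_le_ker (T := act KM p) sub1 _ (dimp KM p _)); [|lia|].
    by move=> v [/weights_act].
  apply: (dim_le_ker (T := act KY p) sub2 _ (dimp KY p _)); [|lia|].
    by move=> v [[/weights_act]].
  apply: (dim_le_ker (T := act KL (p + 1)) sub3 _ (dimp KL (p + 1) _) ker0); [|lia].
  by move=> v [[[/weights_act]]].
have [|[]//|N Nv] := @killed_of_generators p v _ _ lp1; first by rewrite /p; lia.
apply: (highest_weight_of_killed irr hc v0_neq0 Wv0).
by apply: irreducible_full irr killed_submodule _ v_neq0; exists N.
Qed.

End Module.

Section Reflection.
Variables (F : fieldType) (hF : [pchar F] =i pred0) (hs : bool).
Variables (V : lmodType F) (W : SVmodule hs V).

(* The automorphism [L_n -> - L_(-n)], [M_n -> - M_(-n)], [Y_(n+s) -> Y_(-n-s)]. *)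
Definition reflection : SVmodule hs V.
Proof.
refine (@SVModule F hs V (fun n => \- actL W (- n)) (fun n => \- actM W (- n))
  (fun n => actY W (- n - (hs : nat)%:Z)) _ _ _ _ _ _) => m n v /=.
- rewrite (linearN (actL W (- m))) (linearN (actL W (- n))) !opprK relLL.
  by rewrite scalerN -scaleNr -rmorphN; congr (_%:~R *: actL W _ v); lia.
- rewrite (linearN (actL W (- m))) (linearN (actM W (- n))) !opprK relLM.
  by rewrite scalerN -scaleNr -rmorphN; congr (_%:~R *: actM W _ v); lia.
- rewrite (linearN (actY W _)) opprK -[_ + _]opprK opprD opprK relLY -scaleNr.
  congr (_ *: actY W _ v); last by lia.
  rewrite /sval !rmorphD !rmorphN /=.
  by case: (hs) => /=; field; exact: two_neq0.
- rewrite relYY scalerN -scaleNr -rmorphN.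
  by congr (_%:~R *: actM W _ v); lia.
- by rewrite (linearN (actM W (- m))) (linearN (actM W (- n))) relMM.
by rewrite (linearN (actY W _)) relYM.
Defined.

Lemma reflection_submodule S : submodule reflection S -> submodule W S.
Proof.
case=> S0 SD SZ Sact; split=> // n v Sv.
have SN u : S (- u) -> S u by rewrite -{2}[u]opprK -[- - u]scaleN1r; apply: SZ.
have [/= Ln Mn _] := Sact (- n) v Sv; rewrite opprK in Ln Mn.
have [_ _ /=] := Sact (- n - (hs : nat)%:Z) v Sv.
rewrite (_ : - (_ - _) - _ = n) => [Yn|]; last by lia.
by split; [apply: SN | apply: SN |].
Qed.

Lemma submodule_reflection S : submodule W S -> submodule reflection S.
Proof.
case=> S0 SD SZ Sact; split=> // n v Sv /=.
have SN u : S u -> S (- u) by rewrite -scaleN1r; apply: SZ.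
have [Ln Mn _] := Sact (- n) v Sv.
have [_ _ Yn] := Sact (- n - (hs : nat)%:Z) v Sv.
by split=> //; apply: SN.
Qed.

Lemma irreducible_reflection : irreducible W -> irreducible reflection.
Proof. by case=> nz irr; split=> // S /reflection_submodule/irr. Qed.

Lemma reflection_weight a b v :
  weight_space reflection (- a, - b) v <-> weight_space W (a, b) v.
Proof.
rewrite /weight_space /= oppr0 !scaleNr.
by split=> [[/oppr_inj e1 /oppr_inj e2]|[-> ->]].
Qed.

Lemma harish_chandra_reflection : harish_chandra W -> harish_chandra reflection.
Proof.
case=> sums dims; split=> [v|[a b]].
  have [s [Ws ->]] := sums v; exists s; split=> // w /Ws[[a b] Ww].
  by exists (- a, - b); apply/reflection_weight.
have [d Hd] := dims (- a, - b); exists d; apply: dim_le_mono Hd => // v Wv.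
by apply/reflection_weight; rewrite !opprK.
Qed.

Lemma lowest_weight_reflection :
  highest_weight_module reflection -> lowest_weight_module W.
Proof.
case=> v [v0 [[a b] Wv] LM Y gen]; exists v; split=> //.
- by exists (- a, - b); apply/reflection_weight; rewrite !opprK.
- move=> n n_lt0; have [|/= Ln Mn] := LM (- n); first by rewrite oppr_gt0.
  by rewrite opprK in Ln Mn; split; apply: oppr_inj; rewrite oppr0.
- move=> n; rewrite /Yneg => n_lt0.
  have /= := Y (- n - (hs : nat)%:Z).
  by rewrite (_ : - (_ - _) - _ = n); [apply|]; rewrite /Ypos; lia.
by move=> S subS; apply: gen; apply: submodule_reflection.
Qed.

End Reflection.

Theorem theorem1p2 (F : closedFieldType) (hF : [pchar F] =i pred0)
  (hs : bool) (V : lmodType F) (W : SVmodule hs V) :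
  irreducible W -> harish_chandra W ->
  highest_weight_module W \/ lowest_weight_module W \/ uniformly_bounded W.
Proof.
move=> irr hc.
have [v0 [v0_neq0 [[a b] Wv0]]] : exists v, v != 0 /\ weight_vector W v.
  have [[v v_neq0] _] := irr; have [[|x s] [Ws def_v]] := hc.1 v.
    by rewrite def_v big_nil eqxx in v_neq0.
  apply: NNPP => nw; case/eqP: v_neq0; rewrite def_v big_seq big1 // => y sy.
  by apply/eqP/negPn/negP => y0; apply: nw; exists y; split=> //; apply: Ws.
have W0 : weights W a b 0 v0 by rewrite /weights mul0r addr0.
have W0' : weights (reflection hF W) (- a) (- b) 0 v0.
  by rewrite /weights mul0r addr0; apply/reflection_weight.
have [[Nneg Hneg]|nneg] :=
  classic (exists N, forall j, j < 0 -> dim_le (weights W a b j) N); last first.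
  left; apply: (highest_weight_of_unbounded hF irr hc v0_neq0 W0) => N.
  apply: NNPP => nN; apply: nneg; exists N => j j_lt0.
  by apply: NNPP => nd; apply: nN; exists j.
have [[Npos Hpos]|npos] :=
  classic (exists N, forall j, 0 < j -> dim_le (weights W a b j) N); last first.
  right; left; apply: (lowest_weight_reflection (hF := hF)).
  apply: (highest_weight_of_unbounded hF (irreducible_reflection hF irr)
    (harish_chandra_reflection hF hc) v0_neq0 W0') => N.
  apply: NNPP => nN; apply: npos; exists N => j j_gt0.
  apply: NNPP => nd; apply: nN; exists (- j); split; first by rewrite oppr_lt0.
  apply: contra_not nd; apply: dim_le_mono => // v Wv.
  rewrite /weights rmorphN mulNr -opprD.
  exact/reflection_weight.
right; right; have [d Hd] := hc.2 (a, b).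
exists (Nneg + Npos + d)%N => lam; apply: NNPP => nd.
have [w Ww w_neq0]: exists2 w, weight_space W lam w & w != 0.
  by apply: not_dim_le0; apply: contra_not nd; apply: dim_le_mono.
have [j def_lam] := weights_full hF irr hc v0_neq0 W0 w_neq0 Ww.
rewrite {}def_lam in nd; apply: nd.
have [j_lt0|j_gt0|j0] := ltgtP j 0.
- by apply: dim_le_mono (Hneg j j_lt0) => //; lia.
- by apply: dim_le_mono (Hpos j j_gt0) => //; lia.
by rewrite j0 mul0r addr0; apply: dim_le_mono Hd => //; lia.
Qed.
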